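(* Let $p>2$ and $n\ge 2$ be integers. Then the maximum of the sum $$S_{n,p}=\sum_{i=1}^n x_i^p$$ over $(x_1,\dots,x_n)\in\mathbb{R}^n$, subject to the constraints $\sum_{i=1}^n x_i=0$ and $\sum_{i=1}^n x_i^2=1$, is assumed at the point $$x_1=\left(1-\tfrac1n\right)^{1/2},\qquad x_2=\dots=x_n=-\left[n(n-1)\right]^{-1/2}.$$ The maximal value of $S_{n,p}$ then equals $$S^*_{n,p}=\frac{(n-1)^{p-1}+(-1)^p}{n^{p/2}(n-1)^{p/2-1}}.$$ *)

(* Defs.v *)
From HB Require Import structures.
From mathcomp Require Import all_boot all_order all_algebra.
From mathcomp Require Import reals exp.

Set Implicit Arguments.
Unset Strict Implicit.
Unset Printing Implicit Defensive.

Import Order.TTheory GRing.Theory Num.Theory.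
Local Open Scope ring_scope.

Definition power_sum (R : realType) (n p : nat) (x : 'rV[R]_n) : R :=
  \sum_(i < n) x 0 i ^+ p.

Definition feasible (R : realType) (n : nat) (x : 'rV[R]_n) : Prop :=
  \sum_(i < n) x 0 i = 0 /\ \sum_(i < n) x 0 i ^+ 2 = 1.

(* The coordinate x_1 is the one with ordinal index 0. *)
Definition extremal_point (R : realType) (n : nat) : 'rV[R]_n :=
  \row_(i < n) (if val i == 0%N then (1 - n%:R^-1) `^ (1 / 2)
                else - (n%:R * (n%:R - 1)) `^ (- (1 / 2))).

(* The half-integer exponents p/2 and p/2 - 1 require the real power. *)
Definition extremal_value (R : realType) (n p : nat) : R :=
  ((n%:R - 1) ^+ (p - 1) + (-1) ^+ p)
  / (n%:R `^ (p%:R / 2) * (n%:R - 1) `^ (p%:R / 2 - 1)).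

(* Main.v *)
Require Import Defs.
From HB Require Import structures.
From mathcomp Require Import all_boot all_order all_algebra.
From mathcomp Require Import reals exp.
From mathcomp Require Import all_classical topology normedtype realfun derive.
From mathcomp Require Import ring lra.

(** Even exponents.  Move three coordinates x, y, z at a time, keeping their
    sum 3m and their sum of squares.  The shifted triple u, v, w = x - m, y - m,
    z - m has sum zero and u^2 + v^2 + w^2 = 6 t^2 for some t >= 0, and Newton's
    recursion for its power sums involves only 3 t^2 and the product u v w,
    which lies in [- 2 t^3, 2 t^3].  Hence each of its power sums is bounded in
    absolute value by the one of (2t, -t, -t) ([zero_sum_power_sum_le]).
    In the binomial expansion of (m + u)^p and its companions all of these
    bounds can be used simultaneously, so that the p-th power sum of the triple
    is at most that of (|m| + 2t, |m| - t, |m| - t).  As p is even, the new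
    triple may be given the sign of m, and then it has the same sum and the same
    sum of squares as the old one; moreover the square of the first entry has
    increased unless the two others were already equal ([merge_triple]).  Choose,
    among the maximizers of the p-th power sum on the compact feasible set, one
    for which x_1^2 is largest: all its coordinates other than x_1 coincide
    ([even_maximizer]).  The constraints then determine it up to a global sign,
    which an even power does not see ([even_power_sum_le]).

    Odd exponents.  Write a and - b for the two values of the extremal point, so
    that a = (n - 1) b, and S_q for the q-th power sum.  A feasible point has
    all its coordinates at most a, so summing
    (x_i + b)^2 (a - x_i) x_i^(p - 3) >= 0, where p - 3 is even, bounds S_p by
    (a - 2b) S_(p-1) + (2ab - b^2) S_(p-2) + a b^2 S_(p-3), with equality at the
    extremal point.  For n >= 3 the three coefficients are nonnegative, and
    induction on p concludes ([power_sum_le]).  For n = 2 all odd power sums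
    vanish. *)

Set Implicit Arguments.
Unset Strict Implicit.
Unset Printing Implicit Defensive.

Import Order.TTheory GRing.Theory Num.Theory.
Import numFieldTopology.Exports numFieldNormedType.Exports.
Local Open Scope ring_scope.

(** * Three variables *)

(** The discriminant of the cubic with roots u, v, w is a square; since
    its linear coefficient is - 3 t^2, it equals
    27 ((2 t^3)^2 - (u v w)^2). *)
Lemma zero_sum_prod_le (R : realFieldType) (u v w t : R) : 0 <= t ->
  u + v + w = 0 -> u ^+ 2 + v ^+ 2 + w ^+ 2 = 6 * t ^+ 2 ->
  `|u * v * w| <= 2 * t ^+ 3.
Proof.
move=> t0 s1 s2.
rewrite -(@ler_pXn2r _ 2) ?nnegrE ?mulr_ge0 ?exprn_ge0 // real_normK ?num_real //.
have w_eq : w = - u - v by lra.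
have t2 : 3 * t ^+ 2 = u ^+ 2 + u * v + v ^+ 2 by rewrite w_eq in s2; lra.
have disc : 27 * ((2 * t ^+ 3) ^+ 2 - (u * v * w) ^+ 2)
    = ((u - v) * (v - w) * (w - u)) ^+ 2.
  have -> : 27 * ((2 * t ^+ 3) ^+ 2 - (u * v * w) ^+ 2)
    = 4 * (3 * t ^+ 2) ^+ 3 - 27 * (u * v * w) ^+ 2 by ring.
  by rewrite t2 w_eq; ring.
have := sqr_ge0 ((u - v) * (v - w) * (w - u)).
by rewrite -disc; lra.
Qed.

(** Both sides satisfy a recursion P_(j+3) = 3 t^2 P_(j+1) + e P_j, where e is
    u v w on the left and 2 t^3 on the right. *)
Lemma zero_sum_power_sum_le (R : realFieldType) (u v w t : R) j : 0 <= t ->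
  u + v + w = 0 -> u ^+ 2 + v ^+ 2 + w ^+ 2 = 6 * t ^+ 2 ->
  `|u ^+ j + v ^+ j + w ^+ j| <= (2 * t) ^+ j + 2 * (- t) ^+ j.
Proof.
move=> t0 s1 s2.
pose P j := u ^+ j + v ^+ j + w ^+ j.
pose T j := (2 * t) ^+ j + 2 * (- t) ^+ j.
have w_eq : w = - u - v by lra.
have t2 : 3 * t ^+ 2 = u ^+ 2 + u * v + v ^+ 2 by rewrite w_eq in s2; lra.
have PE i : P i.+3 = 3 * t ^+ 2 * P i.+1 + u * v * w * P i.
  by rewrite t2 /P w_eq !exprS; ring.
have TE i : T i.+3 = 3 * t ^+ 2 * T i.+1 + 2 * t ^+ 3 * T i.
  by rewrite /T !exprS; ring.
have uvw := zero_sum_prod_le t0 s1 s2.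
suff /(_ j)[] : forall i, [/\ `|P i| <= T i, `|P i.+1| <= T i.+1
    & `|P i.+2| <= T i.+2] by [].
elim=> [|i [le0 le1 le2]].
  split; rewrite /P /T ?expr0 ?expr1.
  - by rewrite ger0_norm; lra.
  - by rewrite s1 normr0; lra.
  - by rewrite s2 ger0_norm ?mulr_ge0 ?sqr_ge0 //; lra.
split=> //; rewrite PE TE (le_trans (ler_normD _ _)) //.
rewrite (normrM _ (P i.+1)) (normrM _ (P i)) lerD //; last exact: ler_pM.
by rewrite ger0_norm ?ler_wpM2l ?mulr_ge0 ?sqr_ge0.
Qed.

(** Term by term in the binomial expansion: as the bound for zero-sum triples is
    two-sided, it survives multiplication by a power of m of either sign. *)
Lemma power_sum_shift_le (R : realFieldType) (m u v w t : R) p :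
  0 <= t ->
  u + v + w = 0 -> u ^+ 2 + v ^+ 2 + w ^+ 2 = 6 * t ^+ 2 ->
  (m + u) ^+ p + (m + v) ^+ p + (m + w) ^+ p
    <= (`|m| + 2 * t) ^+ p + 2 * (`|m| - t) ^+ p.
Proof.
move=> t0 s1 s2; rewrite !exprDn mulr_sumr -!big_split /=.
apply: ler_sum => i _.
have -> : m ^+ (p - i) * u ^+ i *+ 'C(p, i) + m ^+ (p - i) * v ^+ i *+ 'C(p, i)
   + m ^+ (p - i) * w ^+ i *+ 'C(p, i)
  = (m ^+ (p - i) * (u ^+ i + v ^+ i + w ^+ i)) *+ 'C(p, i).
  by rewrite -!mulrnDl -!mulrDr.
have -> : `|m| ^+ (p - i) * (2 * t) ^+ i *+ 'C(p, i)
   + 2 * (`|m| ^+ (p - i) * (- t) ^+ i *+ 'C(p, i))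
  = (`|m| ^+ (p - i) * ((2 * t) ^+ i + 2 * (- t) ^+ i)) *+ 'C(p, i).
  by rewrite mulrnAr -mulrnDl; congr (_ *+ _); ring.
apply: ler_wMn2r; rewrite (le_trans (ler_norm _)) // normrM normrX.
by rewrite ler_wpM2l ?exprn_ge0 // zero_sum_power_sum_le.
Qed.

(** The strict part, that x ^+ 2 grows unless y = z, is what forces equality of
    coordinates at a well chosen maximizer: the p-th power sum itself can be
    stationary, as it is for p = 4 on triples of sum zero. *)
Lemma merge_triple (R : rcfType) (x y z : R) p : ~~ odd p ->
  exists a b : R, [/\ a + b + b = x + y + z,
    a ^+ 2 + b ^+ 2 + b ^+ 2 = x ^+ 2 + y ^+ 2 + z ^+ 2,
    x ^+ p + y ^+ p + z ^+ p <= a ^+ p + b ^+ p + b ^+ p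
  & x ^+ 2 <= a ^+ 2 /\ (x ^+ 2 = a ^+ 2 -> y = z)].
Proof.
move=> ev; pose m := (x + y + z) / 3.
pose u := x - m; pose v := y - m; pose w := z - m.
pose t := Num.sqrt ((u ^+ 2 + v ^+ 2 + w ^+ 2) / 6).
have uvw0 : u + v + w = 0 by rewrite /u /v /w /m; field.
have t0 : 0 <= t by exact: sqrtr_ge0.
have t2 : u ^+ 2 + v ^+ 2 + w ^+ 2 = 6 * t ^+ 2.
  rewrite sqr_sqrtr; first by field.
  by rewrite divr_ge0 // !addr_ge0 ?sqr_ge0.
(* Num.sg m would not do, as it vanishes at m = 0 *)
have [s [s2 ms]] : exists s : R, s ^+ 2 = 1 /\ m = s * `|m|.
  exists (if 0 <= m then 1 else -1); case: ifP => [m0|/negbT m0].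
    by rewrite expr1n mul1r ger0_norm.
  by rewrite sqrrN expr1n ltr0_norm ?mulN1r ?opprK // ltNge.
have sp : s ^+ p = 1.
  by rewrite -[p]odd_double_half (negbTE ev) add0n -mul2n exprM s2 expr1n.
exists (s * (`|m| + 2 * t)), (s * (`|m| - t)).
have xE : x = m + u by rewrite /u; ring.
have yE : y = m + v by rewrite /v; ring.
have zE : z = m + w by rewrite /w; ring.
have m2 : `|m| ^+ 2 = m ^+ 2 by rewrite real_normK ?num_real.
split.
- have -> : x + y + z = 3 * m + (u + v + w) by rewrite xE yE zE; ring.
  by rewrite uvw0 [in RHS]ms; ring.
- rewrite !exprMn s2 !mul1r.
  have -> : x ^+ 2 + y ^+ 2 + z ^+ 2
     = 3 * m ^+ 2 + 2 * m * (u + v + w) + (u ^+ 2 + v ^+ 2 + w ^+ 2).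
    by rewrite xE yE zE; ring.
  by rewrite uvw0 t2 -m2; ring.
- rewrite !exprMn sp !mul1r xE yE zE.
  have := power_sum_shift_le m p t0 uvw0 t2; lra.
- have gap : 3 * ((2 * t) ^+ 2 - u ^+ 2) = (y - z) ^+ 2.
    have -> : 3 * ((2 * t) ^+ 2 - u ^+ 2)
      = 2 * (6 * t ^+ 2) - 3 * u ^+ 2 by ring.
    have -> : u = - v - w by lra.
    by rewrite -t2 yE zE; have -> : u = - v - w by [lra]; ring.
  have ut : `|u| <= 2 * t.
    rewrite -(@ler_pXn2r _ 2) ?nnegrE ?mulr_ge0 // real_normK ?num_real //.
    by have := sqr_ge0 (y - z); lra.
  have xt : `|x| <= `|m| + 2 * t.
    by rewrite xE (le_trans (ler_normD _ _)) // lerD2l.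
  have aE : (s * (`|m| + 2 * t)) ^+ 2 = (`|m| + 2 * t) ^+ 2.
    by rewrite exprMn s2 mul1r.
  rewrite aE; split.
    rewrite -real_normK ?num_real // ler_pXn2r ?nnegrE //.
    by rewrite addr_ge0 ?mulr_ge0.
  move=> e; have {}e : `|x| = `|m| + 2 * t.
    apply/eqP; rewrite -(@eqrXn2 _ 2) ?addr_ge0 ?mulr_ge0 //.
    by rewrite real_normK ?num_real // e.
  have {}ut : `|u| = 2 * t.
    by apply/le_anti; rewrite ut -(lerD2l `|m|) -e xE ler_normD.
  apply/eqP; rewrite -subr_eq0 -sqrf_eq0 -gap -ut real_normK ?num_real //.
  by rewrite subrr mulr0.
Qed.

(** * The extremal point *)

(** The first coordinate of the extremal point is (n - 1) b and the others are
    - b.  The first two properties characterize b, so the real powers of the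
    definition can be forgotten. *)
Lemma extremal_pointE (R : realType) n : (2 <= n)%N ->
  exists b : R, [/\ 0 <= b, n%:R * (n%:R - 1) * b ^+ 2 = 1 &
   forall q, power_sum q (extremal_point R n)
     = ((n%:R - 1) * b) ^+ q + (n%:R - 1) * (- b) ^+ q].
Proof.
case: n => [//|[//|n]] _.
have kE : n.+2%:R - 1 = n.+1%:R :> R by rewrite -natr1 addrK.
pose b : R := (n.+2%:R * (n.+2%:R - 1)) `^ (- (1 / 2)).
have b2 : n.+2%:R * (n.+2%:R - 1) * b ^+ 2 = 1.
  rewrite /b kE powRN mul1r powR12_sqrt ?mulr_ge0 // exprVn sqr_sqrtr ?mulr_ge0 //.
  by rewrite mulfV // mulf_neq0 // pnatr_eq0.
have aE : (1 - n.+2%:R^-1) `^ (1 / 2) = (n.+2%:R - 1) * b.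
  rewrite mul1r powR12_sqrt ?subr_ge0 ?invf_le1 ?ler1n //.
  rewrite -[RHS]ger0_norm -?sqrtr_sqr; last by rewrite kE mulr_ge0 ?powR_ge0.
  congr Num.sqrt; apply: (@mulfI _ n.+2%:R); first by rewrite pnatr_eq0.
  have -> : n.+2%:R * ((n.+2%:R - 1) * b) ^+ 2
    = (n.+2%:R - 1) * (n.+2%:R * (n.+2%:R - 1) * b ^+ 2) by ring.
  by rewrite b2 mulrBr mulfV ?pnatr_eq0 // !mulr1.
exists b; split=> // [|q]; first exact: powR_ge0.
rewrite /power_sum big_ord_recl mxE /= aE; congr (_ + _).
under eq_bigr do rewrite mxE /= -/b.
by rewrite sumr_const card_ord kE mulr_natl.
Qed.

Lemma extremal_point_feasible (R : realType) n : (2 <= n)%N ->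
  feasible (extremal_point R n).
Proof.
move=> /(@extremal_pointE R)[b [_ b2 sE]]; split.
  have <- : power_sum 1 (extremal_point R n) = \sum_(i < n) extremal_point R n 0 i.
    by apply: eq_bigr => i _; rewrite expr1.
  by rewrite sE; ring.
by rewrite -/(power_sum 2 _) sE -[RHS]b2; ring.
Qed.

Lemma power_sum_extremal_value (R : realType) n p : (2 <= n)%N -> (0 < p)%N ->
  power_sum p (extremal_point R n) = extremal_value R n p.
Proof.
case: n => [//|[//|n]] n2 p0.
have [b [b0 b2 ->]] := @extremal_pointE R n.+2 n2.
have kE : n.+2%:R - 1 = n.+1%:R :> R by rewrite -natr1 addrK.
rewrite /extremal_value; rewrite kE in b2 *.
set s := Num.sqrt n.+2%:R : R; set r := Num.sqrt n.+1%:R : R.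
have s2 : s ^+ 2 = n.+2%:R by rewrite sqr_sqrtr.
have r2 : r ^+ 2 = n.+1%:R by rewrite sqr_sqrtr.
have s0 : s != 0 by rewrite gt_eqF ?sqrtr_gt0.
have r0 : r != 0 by rewrite gt_eqF ?sqrtr_gt0.
have sP : n.+2%:R `^ (p%:R / 2) = s ^+ p :> R.
  by rewrite mulrC powRrM powR12_sqrt // powR_mulrn ?sqrtr_ge0.
have rP : n.+1%:R `^ (p%:R / 2 - 1) = r ^+ p / r ^+ 2 :> R.
  rewrite powRB ?pnatr_eq0 ?implybT // powRr1 //.
  by rewrite [_ / 2]mulrC powRrM powR12_sqrt // powR_mulrn ?sqrtr_ge0 // r2.
have bE : b = (s * r)^-1.
  apply/eqP; rewrite -(@eqrXn2 _ 2) ?invr_ge0 ?mulr_ge0 ?sqrtr_ge0 //.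
  rewrite exprVn exprMn s2 r2; apply/eqP.
  apply: (@mulfI _ (n.+2%:R * n.+1%:R)); rewrite ?mulf_neq0 ?pnatr_eq0 //.
  by rewrite b2 mulfV // mulf_neq0 ?pnatr_eq0.
have rQ : (r ^+ 2) ^+ (p - 1) = r ^+ p * r ^+ p / r ^+ 2.
  apply: (@mulfI _ (r ^+ 2)); first by rewrite expf_neq0.
  by rewrite -exprS subn1 prednK // mulrC divfK ?expf_neq0 // exprAC expr2.
rewrite sP rP bE -r2 rQ.
have -> : r ^+ 2 * (s * r)^-1 = r / s by field; rewrite r0 s0.
rewrite expr_div_n (exprNn (s * r)^-1) exprVn exprMn.
have sp0 : s ^+ p != 0 by rewrite expf_neq0.
have rp0 : r ^+ p != 0 by rewrite expf_neq0.
by field; rewrite sp0 rp0 r0.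
Qed.

(** * Existence of a suitable maximizer *)

Definition set_triple (R : realType) n (x : 'rV[R]_n) (i j k : 'I_n) (a b : R) :
    'rV[R]_n :=
  \row_l (if l == i then a else if (l == j) || (l == k) then b else x 0 l).

Lemma sum_set_triple (R : realType) n (x : 'rV[R]_n) (i j k : 'I_n) (a b : R)
    (F : R -> R) : i != j -> i != k -> j != k ->
  \sum_l F (set_triple x i j k a b 0 l) = \sum_l F (x 0 l)
    - (F (x 0 i) + F (x 0 j) + F (x 0 k)) + (F a + F b + F b).
Proof.
move=> ij ik jk.
have split3 (G : 'I_n -> R) : \sum_l G l
    = G i + G j + G k + \sum_(l | (l != i) && (l != j) && (l != k)) G l.
  rewrite (bigD1 i) //= (bigD1 j) 1?eq_sym //= (bigD1 k) /= ?addrA //.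
  by rewrite ![k == _]eq_sym ik jk.
rewrite !split3 !mxE !eqxx [j == i]eq_sym (negbTE ij).
rewrite [k == i]eq_sym (negbTE ik) orbT /=.
under eq_bigr => l /andP[/andP[li lj] lk].
  rewrite mxE (negbTE li) (negbTE lj) (negbTE lk); over.
by rewrite /=; ring.
Qed.

Lemma feasible_set_triple (R : realType) n (x : 'rV[R]_n) (i j k : 'I_n) (a b : R) :
  i != j -> i != k -> j != k -> feasible x ->
  a + b + b = x 0 i + x 0 j + x 0 k ->
  a ^+ 2 + b ^+ 2 + b ^+ 2 = x 0 i ^+ 2 + x 0 j ^+ 2 + x 0 k ^+ 2 ->
  feasible (set_triple x i j k a b).
Proof.
move=> ij ik jk [x1 x2] e1 e2; split.
  by rewrite (sum_set_triple x a b id) // x1 e1; ring.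
by rewrite (sum_set_triple x a b (fun t => t ^+ 2)) // x2 e2; ring.
Qed.

Lemma power_sum_continuous (R : realType) n p :
  continuous (power_sum p : 'rV[R]_n -> R).
Proof.
apply: continuous_big => [|i _ x].
  exact: add_continuous.
apply: (@continuous_comp _ _ _ (fun x : 'rV[R]_n => x 0 i) (fun t => t ^+ p)).
  exact: coord_continuous.
exact: exprn_continuous.
Qed.

(** A closed subset of the cube [-1, 1]^n. *)
Lemma feasible_compact (R : realType) n :
  compact [set x : 'rV[R]_n | feasible x]%classic.
Proof.
have -> : [set x : 'rV[R]_n | feasible x]%classic
    = ([set v : 'rV[R]_n | forall i, `[(-1 : R), 1]%classic (v ord0 i)]
      `&` ((power_sum 1 @^-1` [set 0 : R]) `&` (power_sum 2 @^-1` [set 1 : R])))%classic.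
  apply/seteqP; split=> [x [x1 x2]|x [_ [x1 x2]]]; last first.
    by split=> //; rewrite -[RHS]x1; apply: eq_bigr => i _; rewrite expr1.
  split=> [i|]; last first.
    by split=> //; rewrite /power_sum /= -[RHS]x1; apply: eq_bigr => i _; rewrite expr1.
  rewrite /= in_itv /= -ler_norml -(@ler_pXn2r _ 2) ?nnegrE //.
  rewrite expr1n real_normK ?num_real // -x2 (bigD1 i) //= lerDl.
  by apply: sumr_ge0 => k _; exact: sqr_ge0.
apply: compact_closedI.
  by apply: (@rV_compact R n (fun=> `[-1, 1]%classic)) => _; exact: segment_compact.
apply: closedI; apply: preimage_closed; do ?exact: closed_eq.
- by move=> x _; exact: power_sum_continuous.
- by move=> x _; exact: power_sum_continuous.
Qed.

(** The maximizers of f form a compact set, on which g attains its maximum. *)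
Lemma compact_lex_max (R : realType) (T : topologicalType) (f g : T -> R)
    (A : set T) : (A !=set0)%classic -> compact A -> continuous f -> continuous g ->
  exists c, [/\ A c, forall t, A t -> f t <= f c
    & forall t, A t -> f c <= f t -> g t <= g c].
Proof.
move=> A0 cA cf cg.
have [c /set_mem Ac maxc] := compact_EVT_max A0 cA (continuous_subspaceT cf).
pose B := (A `&` (f @^-1` [set y | f c <= y]))%classic.
have cB : compact B.
  apply: compact_closedI => //; apply: preimage_closed; last exact: closed_ge.
  by move=> x _; exact: cf.
have B0 : (B !=set0)%classic by exists c; split => /=.
have [d /set_mem[Ad cd] maxd] :=
  compact_EVT_max B0 cB (continuous_subspaceT cg).
exists d; split=> // [t At|t At dt].
  by rewrite (le_trans _ cd) // maxc // mem_set.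
by apply: maxd; apply/mem_set; split=> //; exact: le_trans dt.
Qed.

(** Merging x_j and x_k while pushing x_i outwards yields another maximizer of
    the power sum, so maximality of x_i ^+ 2 among maximizers forbids any
    growth of x_i ^+ 2. *)
Lemma even_maximizer (R : realType) n p (i : 'I_n) :
  (2 <= n)%N -> ~~ odd p ->
  exists x : 'rV[R]_n, [/\ feasible x,
    forall y : 'rV[R]_n, feasible y -> power_sum p y <= power_sum p x
  & forall j k, i != j -> i != k -> x 0 j = x 0 k].
Proof.
move=> n2 ev.
have [] := @compact_lex_max R _ (@power_sum R n p) (fun x : 'rV[R]_n => x 0 i ^+ 2)
    [set x : 'rV[R]_n | feasible x]%classic.
- by exists (extremal_point R n); exact: extremal_point_feasible.
- exact: feasible_compact.
- exact: power_sum_continuous.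
- move=> x; apply: (@continuous_comp _ _ _ (fun x : 'rV[R]_n => x 0 i)
    (fun t => t ^+ 2)); first exact: coord_continuous.
  exact: exprn_continuous.
move=> x [/= fx maxx lexx]; exists x; split=> // j k ij ik.
have [->//|jk] := eqVneq j k.
have [a [b [e1 e2 le_p [le_2 eq_2]]]] :=
  merge_triple (x 0 i) (x 0 j) (x 0 k) ev.
have fy := feasible_set_triple ij ik jk fx e1 e2.
apply: eq_2; apply/le_anti; rewrite le_2 /=.
have /= := lexx _ fy; rewrite mxE eqxx; apply.
rewrite [leRHS](sum_set_triple x a b (fun t => t ^+ p)) //.
by rewrite -/(power_sum p x); lra.
Qed.

(** * The upper bound *)

Lemma even_power_sum_le (R : realType) n p (x : 'rV[R]_n) :
  (2 <= n)%N -> ~~ odd p -> feasible x ->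
  power_sum p x <= power_sum p (extremal_point R n).
Proof.
case: n x => [//|[//|n]] x n2 ev fx.
have [y [fy maxy eqy]] := @even_maximizer R n.+2 p ord0 n2 ev.
apply: le_trans (maxy _ fx) _.
have [b [b0 b2 ->]] := @extremal_pointE R n.+2 n2.
have kE : n.+2%:R - 1 = n.+1%:R :> R by rewrite -natr1 addrK.
have sumE q : \sum_i y 0 i ^+ q
    = y 0 ord0 ^+ q + (n.+2%:R - 1) * y 0 (lift ord0 ord0) ^+ q.
  rewrite big_ord_recl kE; congr (_ + _).
  under eq_bigr => j _ do rewrite (eqy _ (lift ord0 ord0)) //.
  by rewrite sumr_const card_ord mulr_natl.
have [y1 y2] := fy.
have {}y1 : y 0 ord0 + (n.+2%:R - 1) * y 0 (lift ord0 ord0) = 0.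
  by rewrite -[RHS]y1 -[LHS](sumE 1); apply: eq_bigr => j _; rewrite expr1.
rewrite /power_sum sumE; rewrite sumE in y2.
set c := y 0 (lift _ _) in y1 y2 *; set M := y 0 ord0 in y1 y2 *.
have ME : M = - (n.+2%:R - 1) * c by lra.
have n0 : n.+2%:R != 0 :> R by rewrite pnatr_eq0.
have k0 : n.+2%:R - 1 != 0 :> R by rewrite kE pnatr_eq0.
have c2 : c ^+ 2 = b ^+ 2.
  apply: (@mulfI _ (n.+2%:R * (n.+2%:R - 1))); first by rewrite mulf_neq0.
  by rewrite b2 -[RHS]y2 ME; ring.
have evE (t : R) : t ^+ p = (t ^+ 2) ^+ p./2.
  by rewrite -exprM mul2n -[LHS]/(t ^+ p) -{1}[p]odd_double_half (negbTE ev).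
have M2 : M ^+ 2 = ((n.+2%:R - 1) * b) ^+ 2 by rewrite ME exprMn sqrrN c2 -exprMn.
by rewrite (evE M) (evE c) (evE (- b)) (evE (_ * b)) M2 c2 sqrrN.
Qed.

(** Cauchy-Schwarz for the coordinates other than x_i, whose mean is - m: their
    variance is nonnegative. *)
Lemma feasible_sqr_le (R : realType) n (x : 'rV[R]_n) i : (2 <= n)%N ->
  feasible x -> n%:R * x 0 i ^+ 2 <= n%:R - 1.
Proof.
case: n x i => [//|[//|n]] x i _ [x1 x2].
have kE : n.+2%:R - 1 = n.+1%:R :> R by rewrite -natr1 addrK.
have k0 : 0 < n.+2%:R - 1 :> R by rewrite kE ltr0n.
rewrite (bigD1 i) //= in x1; rewrite (bigD1 i) //= in x2.
pose m := x 0 i / (n.+2%:R - 1).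
have : 0 <= \sum_(j | j != i) (x 0 j + m) ^+ 2.
  by apply: sumr_ge0 => j _; exact: sqr_ge0.
under eq_bigr => j _.
  have -> : (x 0 j + m) ^+ 2 = x 0 j ^+ 2 + 2 * m * x 0 j + m ^+ 2 by ring.
  over.
rewrite !big_split /= -mulr_sumr sumr_const.
have -> : #|[pred j | j != i]| = n.+1 by rewrite cardC1 card_ord.
rewrite -[m ^+ 2 *+ _]mulr_natl -kE.
have -> : \sum_(j | j != i) x 0 j ^+ 2 = 1 - x 0 i ^+ 2 by lra.
have -> : \sum_(j | j != i) x 0 j = - x 0 i by lra.
rewrite -(ler_pM2l k0) mulr0.
have mE : x 0 i = (n.+2%:R - 1) * m by rewrite /m mulrC divfK ?gt_eqF.
have -> : (n.+2%:R - 1) * (1 - x 0 i ^+ 2 + 2 * m * (- x 0 i)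
    + (n.+2%:R - 1) * m ^+ 2) = n.+2%:R - 1 - n.+2%:R * x 0 i ^+ 2.
  by rewrite mE; ring.
by lra.
Qed.

(** The sum over i of (x_i + b)^2 (a - x_i) x_i^j >= 0. *)
Lemma power_sum_rec_le (R : realType) n j (x : 'rV[R]_n) (a b : R) :
  ~~ odd j -> (forall i, x 0 i <= a) ->
  power_sum j.+3 x <= (a - 2 * b) * power_sum j.+2 x
    + (2 * a * b - b ^+ 2) * power_sum j.+1 x + a * b ^+ 2 * power_sum j x.
Proof.
move=> ev xa; rewrite /power_sum !mulr_sumr -!big_split /=.
apply: ler_sum => i _; set t := x 0 i.
have tj : 0 <= t ^+ j by rewrite exprn_even_ge0.
have : 0 <= (t + b) ^+ 2 * (a - t) * t ^+ j.
  by rewrite (mulr_ge0 _ tj) // mulr_ge0 ?sqr_ge0 // subr_ge0 xa.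
have -> : (t + b) ^+ 2 * (a - t) * t ^+ j = (a - 2 * b) * t ^+ j.+2
   + (2 * a * b - b ^+ 2) * t ^+ j.+1 + a * b ^+ 2 * t ^+ j - t ^+ j.+3.
  by rewrite !exprS; ring.
by lra.
Qed.

(** The bound on n makes the coefficient a - 2 b = (n - 3) b nonnegative. *)
Lemma power_sum_le (R : realType) n p (x : 'rV[R]_n) :
  (3 <= n)%N -> feasible x ->
  power_sum p x <= power_sum p (extremal_point R n).
Proof.
move=> n3 fx; have n2 := ltnW n3.
have [b [b0 b2 sE]] := @extremal_pointE R n n2.
have n3R : 3 <= n%:R :> R by rewrite ler_nat.
set a := (n%:R - 1) * b in sE.
have a0 : 0 <= a by rewrite mulr_ge0 //; lra.
have xa i : x 0 i <= a.
  apply: le_trans (ler_norm _) _.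
  rewrite -(@ler_pXn2r _ 2) ?nnegrE // real_normK ?num_real //.
  rewrite -(@ler_pM2l _ n%:R); last by lra.
  apply: le_trans (feasible_sqr_le i n2 fx) _.
  have -> : n%:R * a ^+ 2 = (n%:R - 1) * (n%:R * (n%:R - 1) * b ^+ 2).
    by rewrite /a; ring.
  by rewrite b2 mulr1.
elim/ltn_ind: p => p IHp.
have [odd_p|ev] := boolP (odd p); last exact: even_power_sum_le.
case: p odd_p IHp => [//|[|[//|j]]] odd_p IHp.
  have [x1 _] := fx; have [e1 _] := @extremal_point_feasible R n n2.
  rewrite /power_sum; under eq_bigr do rewrite expr1.
  by rewrite x1; under eq_bigr do rewrite expr1; rewrite e1.
have ev : ~~ odd j by move: odd_p => /=; rewrite !negbK.
apply: le_trans (power_sum_rec_le b ev xa) _.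
have -> : power_sum j.+3 (extremal_point R n)
  = (a - 2 * b) * power_sum j.+2 (extremal_point R n)
    + (2 * a * b - b ^+ 2) * power_sum j.+1 (extremal_point R n)
    + a * b ^+ 2 * power_sum j (extremal_point R n).
  by rewrite !sE !exprS; ring.
rewrite !lerD // ler_wpM2l ?IHp //.
- have -> : a - 2 * b = (n%:R - 3) * b by rewrite /a; ring.
  by rewrite mulr_ge0 //; lra.
- have -> : 2 * a * b - b ^+ 2 = (2 * n%:R - 3) * b ^+ 2 by rewrite /a; ring.
  by rewrite mulr_ge0 ?sqr_ge0 //; lra.
- by rewrite mulr_ge0 ?sqr_ge0.
- by rewrite ltnS -addn2 leq_addr.
Qed.

Lemma power_sum_dim2_odd (R : realType) p (x : 'rV[R]_2) : odd p ->
  feasible x -> power_sum p x = 0.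
Proof.
move=> op [+ _]; rewrite /power_sum !big_ord_recl !big_ord0 !addr0 => x1.
have -> : x 0 (lift ord0 ord0) = - x 0 ord0 by lra.
by rewrite exprNn -signr_odd op mulN1r subrr.
Qed.

Theorem theorem5 (R : realType) (n p : nat) (hp : (2 < p)%N) (hn : (2 <= n)%N) :
  [/\ feasible (extremal_point R n),
      (forall x : 'rV[R]_n, feasible x ->
         power_sum p x <= power_sum p (extremal_point R n))
    & power_sum p (extremal_point R n) = extremal_value R n p].
Proof.
split; first exact: extremal_point_feasible; last first.
  by apply: power_sum_extremal_value => //; apply: leq_trans hp.
have fe := @extremal_point_feasible R n hn.
move=> x fx; have [n3|] := leqP 3 n; first exact: power_sum_le.
move=> n2; have {n2} n2 : n = 2%N by apply/eqP; rewrite eqn_leq -ltnS n2.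
subst n; have [odd_p|ev] := boolP (odd p); last exact: even_power_sum_le.
by rewrite !power_sum_dim2_odd.
Qed.
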